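(* Let $u$ be the exact solution of the interface problem and $R_{i,j}=L_hu(x_i,y_j)-h^2f(x_i,y_j)$, $(i,j)\in S_0$, the local truncation error of the five-point scheme, as described in the context. If $u\in W$, then the following hold. 1) For interior nodes not adjacent to the interface, $$R_{i,j}=(\kappa^-)^{\delta_{1,k}}\,C^{(4)}(x_i,y_j)\,h^4+O(h^6),\qquad (i,j)\in S_k^I,\ k=1,2,$$ where $\delta_{1,k}$ is the Kronecker delta and $$C^{(4)}(x,y)=-\frac1{12}\Big(\frac{\partial^4u}{\partial y^4}+\frac{\partial^4u}{\partial x^4}+6\frac{\partial^4u}{\partial y^2\partial x^2}\Big)(x,y).$$ 2) For interior nodes adjacent to the interface, $$R_{i,j}=C_i^{(1)}(y_j)h+C_i^{(2)}(y_j)h^2+C_i^{(3)}(y_j)h^3+O(h^4),\qquad (i,j)\in S_B=S_1^B\cup S_2^B,$$ where $$C_M^{(1)}(y)=\Big(\kappa^--\frac{\kappa^*}2-\frac{\kappa^*\kappa^-}2\Big)\Big(\frac{\partial u}{\partial x}\Big)^-(y),\qquad C_{M+1}^{(1)}(y)=-C_M^{(1)}(y),$$ $$C_M^{(2)}(y)=\frac{\kappa^*}8\Big[\frac{\partial^2u}{\partial x^2}\Big](y)+\frac12\Big(\kappa^-\Big(\frac{\partial^2u}{\partial y^2}\Big)^--\kappa^*\Big(\frac{\partial^2u}{\partial y^2}\Big)^+\Big)(y),$$ $$C_{M+1}^{(2)}(y)=-\frac{\kappa^*}8\Big[\frac{\partial^2u}{\partial x^2}\Big](y)+\frac12\Big(\Big(\frac{\partial^2u}{\partial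 y^2}\Big)^+-\kappa^*\Big(\frac{\partial^2u}{\partial y^2}\Big)^-\Big)(y),$$ $$C_M^{(3)}(y)=\Big(\frac{\kappa^-}{24}\Big(\frac{\partial^3u}{\partial x^3}\Big)^--\frac{\kappa^*}{24}\Big\{\frac{\partial^3u}{\partial x^3}\Big\}+\frac14\Big(\kappa^-\Big(\frac{\partial^3u}{\partial y^2\partial x}\Big)^--\kappa^*\Big(\frac{\partial^3u}{\partial y^2\partial x}\Big)^+\Big)\Big)(y),$$ $$C_{M+1}^{(3)}(y)=\Big(-\frac1{24}\Big(\frac{\partial^3u}{\partial x^3}\Big)^++\frac{\kappa^*}{24}\Big\{\frac{\partial^3u}{\partial x^3}\Big\}+\frac14\Big(-\Big(\frac{\partial^3u}{\partial y^2\partial x}\Big)^++\kappa^*\Big(\frac{\partial^3u}{\partial y^2\partial x}\Big)^-\Big)\Big)(y).$$ Here $(\zeta)^\pm(y)=\lim_{x\to(1/2)^\pm}\zeta(x,y)$, $[\zeta]=(\zeta)^--(\zeta)^+$ and $\{\zeta\}=\frac12((\zeta)^-+(\zeta)^+)$.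
   Context: Interface problem. $\Omega=(0,1)\times(0,1)$, $D_1=(0,\frac12)\times(0,1)$, $D_2=(\frac12,1)\times(0,1)$, $\Gamma=\{x=\frac12\}$ is the interface. $\kappa=\kappa^-$ in $D_1$ with a constant $\kappa^-\ge 1$, and $\kappa=1$ in $D_2$. The exact solution $u$ satisfies $-\nabla\cdot(\kappa\nabla u)+u=f$ in $\Omega$ (in $D_1$ and in $D_2$), $u=0$ on $\partial\Omega$, and $[u]=[\kappa\,\partial u/\partial \vec n]=0$ on $\Gamma$, where $[\cdot]$ is the jump across $\Gamma$ and $\vec n$ is the unit normal to $\Gamma$. $W=\{w:\ w|_{\bar D_i}\in C^6(\bar D_i),\ i=1,2\}$. Grid. $N=2M+1$ with $M$ a positive integer, $h=1/N$, $x_i=ih$, $y_j=jh$ ($0\le i,j\le N$), so $\Gamma$ is the line $x=x_M+\frac h2$. $S_1^I=\{(i,j):1\le i\le M-1,1\le j\le N-1\}$, $S_2^I=\{(i,j):M+2\le i\le N-1,1\le j\le N-1\}$, $S_1^B=\{(M,j):1\le j\le N-1\}$, $S_2^B=\{(M+1,j):1\le j\le N-1\}$, $S_0=\{1,\dots,N-1\}^2$. Scheme operator. $\kappa^*$ is a fixed average of $\kappa^-$ and $1$ (e.g. arithmetic or harmonic; $1\le\kappa^*\le\kappa^-$, independent of $h$). For a grid function $v$, $$L_hv_{i,j}=a_1^{i,j}v_{i-1,j-1}+a_2^{i,j}v_{i+1,j-1}+a_3^{i,j}v_{i,j}+a_4^{i,j}v_{i-1,j+1}+a_5^{i,j}v_{i+1,j+1},$$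 with: on $S_1^I$: $a_1=a_2=a_4=a_5=-\frac12\kappa^-$, $a_3=2\kappa^-+h^2$; on $S_1^B$: $a_1=a_4=-\frac12\kappa^-$, $a_2=a_5=-\frac12\kappa^*$, $a_3=\kappa^-+\kappa^*+h^2$; on $S_2^B$: $a_1=a_4=-\frac12\kappa^*$, $a_2=a_5=-\frac12$, $a_3=\kappa^*+1+h^2$; on $S_2^I$: $a_1=a_2=a_4=a_5=-\frac12$, $a_3=2+h^2$. $L_hu(x_i,y_j)$ means $L_h$ applied to the grid function $(u(x_i,y_j))$. The constants in the $O(\cdot)$ terms are independent of $h,i,j$ (they may depend on $u,\kappa^-,\kappa^*$). *)

(* Defs.v *)
From Stdlib Require Import Reals Arith Lra Lia.
From Coquelicot Require Import Coquelicot.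
Open Scope R_scope.

Definition open_rect (a b c d : R) (p : R * R) : Prop :=
  a < fst p < b /\ c < snd p < d.

Definition closed_rect (a b c d : R) (p : R * R) : Prop :=
  a <= fst p <= b /\ c <= snd p <= d.

Definition Omega_bar : R * R -> Prop := closed_rect 0 1 0 1.
Definition D1 : R * R -> Prop := open_rect 0 (1 / 2) 0 1.
Definition D2 : R * R -> Prop := open_rect (1 / 2) 1 0 1.
Definition D1_bar : R * R -> Prop := closed_rect 0 (1 / 2) 0 1.
Definition D2_bar : R * R -> Prop := closed_rect (1 / 2) 1 0 1.

Definition boundary_Omega (p : R * R) : Prop :=
  Omega_bar p /\ (fst p = 0 \/ fst p = 1 \/ snd p = 0 \/ snd p = 1).

(* [w] is of class C^k on the open set [D], and its partial derivatives of
   order at most [k] extend continuously to the closure [Dbar], the extension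
   of [w] itself being [w].  [ex_diff_n w k x y] says that all iterated partial
   derivatives up to order [k], in every order of differentiation, exist and
   are continuous at (x, y); [partial_derive m n w] is d^m/dx^m d^n/dy^n w. *)
Definition Ck_closure (k : nat) (D Dbar : R * R -> Prop) (w : R -> R -> R)
  : Prop :=
  (forall x y : R, D (x, y) -> ex_diff_n w k x y) /\
  continuous_on Dbar (fun p : R * R => w (fst p) (snd p)) /\
  (forall m n : nat, (m + n <= k)%nat ->
     exists g : R * R -> R,
       continuous_on Dbar g /\
       forall x y : R, D (x, y) -> g (x, y) = partial_derive m n w x y).

(* Functions of W may be two-valued on the interface: the restriction of [w]
   to the closure of D_i is the C^6 function [w1] (resp. [w2]) with which [w]
   agrees off the interface.  The value of [w] on x = 1/2 plays no role. *)
Definition W (w : R -> R -> R) : Prop :=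
  (exists w1 : R -> R -> R, Ck_closure 6 D1 D1_bar w1 /\
     forall x y : R, D1_bar (x, y) -> x <> 1 / 2 -> w x y = w1 x y) /\
  (exists w2 : R -> R -> R, Ck_closure 6 D2 D2_bar w2 /\
     forall x y : R, D2_bar (x, y) -> x <> 1 / 2 -> w x y = w2 x y).

(* One-sided limits at the interface. [lim] is Coquelicot's total limit of a
   filter; it is the limit whenever the limit exists (see [tr_minus_eq] and
   [tr_plus_eq]). *)
Definition tr_minus (z : R -> R -> R) (y : R) : R :=
  lim (filtermap (fun x : R => z x y) (at_left (1 / 2))).

Definition tr_plus (z : R -> R -> R) (y : R) : R :=
  lim (filtermap (fun x : R => z x y) (at_right (1 / 2))).

Definition jump (z : R -> R -> R) (y : R) : R := tr_minus z y - tr_plus z y.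

Definition mean (z : R -> R -> R) (y : R) : R :=
  / 2 * (tr_minus z y + tr_plus z y).

Lemma lim_filter_eq (F : (R -> Prop) -> Prop) (FF : ProperFilter F) (l : R) :
  filterlim (fun t : R => t) F (locally l) -> lim F = l.
Proof.
  intros Hl.
  assert (Hc : cauchy F).
  { intros eps. exists l. apply (Hl (ball l eps)). now exists eps. }
  apply eq_close. intros eps.
  pose proof (complete_cauchy F FF Hc (pos_div_2 eps)) as H1.
  assert (H2 : F (ball l (pos_div_2 eps))).
  { apply (Hl (ball l (pos_div_2 eps))). now exists (pos_div_2 eps). }
  destruct (filter_ex _ (filter_and _ _ H1 H2)) as [t [Ha Hb]].
  replace (pos eps) with (pos_div_2 eps + pos_div_2 eps) by (simpl; lra).
  apply ball_triangle with t; [exact Ha | now apply ball_sym].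
Qed.

Lemma tr_minus_eq (z : R -> R -> R) (y l : R) :
  filterlim (fun x : R => z x y) (at_left (1 / 2)) (locally l) ->
  tr_minus z y = l.
Proof.
  intros H. apply lim_filter_eq; [apply filtermap_proper_filter, at_left_proper_filter | exact H].
Qed.

Lemma tr_plus_eq (z : R -> R -> R) (y l : R) :
  filterlim (fun x : R => z x y) (at_right (1 / 2)) (locally l) ->
  tr_plus z y = l.
Proof.
  intros H. apply lim_filter_eq; [apply filtermap_proper_filter, at_right_proper_filter | exact H].
Qed.

Definition kappa (km x y : R) : R := if Rlt_dec x (1 / 2) then km else 1.

(* div (kappa grad u) *)
Definition div_kappa_grad (km : R) (u : R -> R -> R) (x y : R) : R :=
  Derive (fun s : R => kappa km s y * partial_derive 1 0 u s y) x +
  Derive (fun t : R => kappa km x t * partial_derive 0 1 u x t) y.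

(* The unit normal to the interface is (1, 0), so du/dn is du/dx. *)
Definition exact_solution (km : R) (f u : R -> R -> R) : Prop :=
  (forall x y : R, D1 (x, y) \/ D2 (x, y) ->
     - div_kappa_grad km u x y + u x y = f x y) /\
  (forall x y : R, boundary_Omega (x, y) -> u x y = 0) /\
  (forall y : R, 0 < y < 1 -> jump u y = 0) /\
  (forall y : R, 0 < y < 1 ->
     jump (fun x t : R => kappa km x t * partial_derive 1 0 u x t) y = 0).

Definition gridN (M : nat) : nat := (2 * M + 1)%nat.
Definition gridh (M : nat) : R := 1 / INR (gridN M).
Definition gridpt (M i : nat) : R := INR i * gridh M.

(* [SI M k] is S_k^I, for k = 1, 2. *)
Definition SI (M k i j : nat) : Prop :=
  (k = 1 /\ 1 <= i <= M - 1 /\ 1 <= j <= gridN M - 1 \/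
   k = 2 /\ M + 2 <= i <= gridN M - 1 /\ 1 <= j <= gridN M - 1)%nat.

Definition S1B (M i j : nat) : Prop :=
  (i = M /\ 1 <= j <= gridN M - 1)%nat.
Definition S2B (M i j : nat) : Prop :=
  (i = M + 1 /\ 1 <= j <= gridN M - 1)%nat.
Definition SB (M i j : nat) : Prop := S1B M i j \/ S2B M i j.

Inductive region : Set := RegI1 | RegB1 | RegB2 | RegI2.

(* Which of S_1^I, S_1^B, S_2^B, S_2^I a node of S_0 with first index i lies in. *)
Definition region_of (M i : nat) : region :=
  if (i <? M)%nat then RegI1
  else if (i =? M)%nat then RegB1
  else if (i =? M + 1)%nat then RegB2
  else RegI2.

Definition coef1 (km ks : R) (r : region) : R :=
  match r with
  | RegI1 => - / 2 * km | RegB1 => - / 2 * km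
  | RegB2 => - / 2 * ks | RegI2 => - / 2
  end.

Definition coef2 (km ks : R) (r : region) : R :=
  match r with
  | RegI1 => - / 2 * km | RegB1 => - / 2 * ks
  | RegB2 => - / 2      | RegI2 => - / 2
  end.

Definition coef3 (km ks h : R) (r : region) : R :=
  match r with
  | RegI1 => 2 * km + h ^ 2  | RegB1 => km + ks + h ^ 2
  | RegB2 => ks + 1 + h ^ 2  | RegI2 => 2 + h ^ 2
  end.

Definition coef4 (km ks : R) (r : region) : R :=
  match r with
  | RegI1 => - / 2 * km | RegB1 => - / 2 * km
  | RegB2 => - / 2 * ks | RegI2 => - / 2
  end.

Definition coef5 (km ks : R) (r : region) : R :=
  match r with
  | RegI1 => - / 2 * km | RegB1 => - / 2 * ks
  | RegB2 => - / 2      | RegI2 => - / 2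
  end.

(* Meaningful for (i, j) in S_0 only, where i - 1 and j - 1 do not truncate. *)
Definition Lh (km ks : R) (M : nat) (v : nat -> nat -> R) (i j : nat) : R :=
  let r := region_of M i in
  coef1 km ks r * v (i - 1)%nat (j - 1)%nat +
  coef2 km ks r * v (i + 1)%nat (j - 1)%nat +
  coef3 km ks (gridh M) r * v i j +
  coef4 km ks r * v (i - 1)%nat (j + 1)%nat +
  coef5 km ks r * v (i + 1)%nat (j + 1)%nat.

Definition trunc_err (km ks : R) (f u : R -> R -> R) (M i j : nat) : R :=
  Lh km ks M (fun i' j' : nat => u (gridpt M i') (gridpt M j')) i j
  - gridh M ^ 2 * f (gridpt M i) (gridpt M j).

Definition kron (a b : nat) : nat := if (a =? b)%nat then 1%nat else 0%nat.

Definition errC4 (u : R -> R -> R) (x y : R) : R :=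
  - / 12 * (partial_derive 0 4 u x y + partial_derive 4 0 u x y
            + 6 * partial_derive 2 2 u x y).

(* C_M^(m) and C_{M+1}^(m), m = 1, 2, 3; the suffix _M1 stands for M+1. *)
Definition errC1_M (km ks : R) (u : R -> R -> R) (y : R) : R :=
  (km - ks / 2 - ks * km / 2) * tr_minus (partial_derive 1 0 u) y.

Definition errC1_M1 (km ks : R) (u : R -> R -> R) (y : R) : R :=
  - errC1_M km ks u y.

Definition errC2_M (km ks : R) (u : R -> R -> R) (y : R) : R :=
  ks / 8 * jump (partial_derive 2 0 u) y
  + / 2 * (km * tr_minus (partial_derive 0 2 u) y
           - ks * tr_plus (partial_derive 0 2 u) y).

Definition errC2_M1 (ks : R) (u : R -> R -> R) (y : R) : R :=
  - (ks / 8) * jump (partial_derive 2 0 u) y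
  + / 2 * (tr_plus (partial_derive 0 2 u) y
           - ks * tr_minus (partial_derive 0 2 u) y).

Definition errC3_M (km ks : R) (u : R -> R -> R) (y : R) : R :=
  km / 24 * tr_minus (partial_derive 3 0 u) y
  - ks / 24 * mean (partial_derive 3 0 u) y
  + / 4 * (km * tr_minus (partial_derive 1 2 u) y
           - ks * tr_plus (partial_derive 1 2 u) y).

Definition errC3_M1 (ks : R) (u : R -> R -> R) (y : R) : R :=
  - / 24 * tr_plus (partial_derive 3 0 u) y
  + ks / 24 * mean (partial_derive 3 0 u) y
  + / 4 * (- tr_plus (partial_derive 1 2 u) y
           + ks * tr_minus (partial_derive 1 2 u) y).

(* C_i^(m) for i = M or i = M + 1. *)
Definition errC1 (km ks : R) (u : R -> R -> R) (M i : nat) (y : R) : R :=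
  if (i =? M)%nat then errC1_M km ks u y else errC1_M1 km ks u y.

Definition errC2 (km ks : R) (u : R -> R -> R) (M i : nat) (y : R) : R :=
  if (i =? M)%nat then errC2_M km ks u y else errC2_M1 ks u y.

Definition errC3 (km ks : R) (u : R -> R -> R) (M i : nat) (y : R) : R :=
  if (i =? M)%nat then errC3_M km ks u y else errC3_M1 ks u y.

(* Main.v *)
Require Import Defs.
From Stdlib Require Import Reals Arith Lra Lia ClassicalEpsilon.
From Coquelicot Require Import Coquelicot.
Open Scope R_scope.

(** The truncation error is read off from Taylor expansions that never cross
    the interface, so only one-sided smoothness of [u] is used.

    Away from the interface the four corners [(x +- h, y +- h)] lie in the
    closure of one subdomain. In the sum of their expansions all odd orders
    cancel, order two is [2 h^2 (u_xx + u_yy)], which the differential equation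
    matches with [h^2 f], order four is [C4], and the remainder has order six
    ([five_point_interior]).

    Next to the interface every value is expanded about the foot [(1/2, y_j)]
    of the node, each with the one-sided derivatives of its own subdomain; with
    [s = -h] on the left and [s = h] on the right, the stencil abscissae are
    [1/2 + 3s/2], [1/2 + s/2] and, across, [1/2 - s/2]. The source term
    contributes [h^2 kappa (u_xx + u_yy)] at the node, to be expanded to first
    order. Continuity of [u] kills order zero and continuity of the flux
    expresses the right normal derivative by the left one
    ([five_point_interface], one statement for both sides).

    The constants must be uniform although stencil points and expansion
    centres may lie on the boundary of a subdomain, where [u] is merely a
    continuous extension. Therefore the derivatives on a subdomain are replaced
    by a [jet]: a family [G m n] of functions continuous on the whole plane,
    which inside the rectangle differentiate into one another. Such a jet exists
    by clamping the extended derivatives to the rectangle ([Ck_closure_jet]).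
    The Taylor inequality with constant given by the maximum of the jet on the
    compact rectangle holds on segments in the interior, and passes to the
    closed rectangle by shrinking towards its centre ([taylor_jet]). The
    one-sided limits at the interface are values of the jets there. *)

(** * Bounds on compact sets *)

(** Uniform continuity gives a step below which [f] varies by less than 1; a
    bounded number of such steps along the segment from the corner [(a, c)]
    reaches every point of the rectangle. *)
Lemma continuity_2d_bounded (f : R -> R -> R) (a b c d : R) :
  (forall x y : R, a <= x <= b -> c <= y <= d -> continuity_2d_pt f x y) ->
  exists B : R, 0 <= B /\
    forall x y : R, a <= x <= b -> c <= y <= d -> Rabs (f x y) <= B.
Proof.
  intros Hf.
  destruct (uniform_continuity_2d f a b c d Hf (mkposreal 1 Rlt_0_1))
    as [[delta Hdelta] Hunif]; simpl in Hunif.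
  destruct (INR_unbounded ((Rabs (b - a) + Rabs (d - c)) / delta)) as [N0 HN0].
  set (N := S N0).
  assert (HN : 0 < INR N) by (apply lt_0_INR; unfold N; lia).
  assert (HNd : Rabs (b - a) + Rabs (d - c) < delta * INR N).
  { apply Rlt_div_l in HN0; [|lra]. unfold N. rewrite S_INR. nra. }
  exists (Rabs (f a c) + INR N). split; [pose proof (Rabs_pos (f a c)); lra|].
  intros x y Hx Hy.
  assert (Hchain : forall n : nat, (n <= N)%nat ->
    Rabs (f (a + INR n / INR N * (x - a)) (c + INR n / INR N * (y - c)))
    <= Rabs (f a c) + INR n).
  { induction n as [|n IH]; intros Hn.
    - simpl INR. unfold Rdiv. rewrite !Rmult_0_l, !Rplus_0_r. lra.
    - specialize (IH ltac:(lia)).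
      assert (H0n := pos_INR n).
      assert (Hsn : INR n + 1 <= INR N) by (rewrite <- S_INR; apply le_INR; lia).
      assert (Hq : 0 <= INR n / INR N /\ (INR n + 1) / INR N <= 1).
      { split; [apply Rdiv_le_0_compat; lra|]. apply Rle_div_l; lra. }
      assert (Hi : 0 < / INR N) by now apply Rinv_0_lt_compat.
      assert (Hsmall : / INR N * (Rabs (b - a) + Rabs (d - c)) < delta).
      { apply Rmult_lt_reg_l with (INR N); [lra|]. rewrite <- Rmult_assoc, Rinv_r by lra. lra. }
      rewrite S_INR in *. rewrite (Rabs_right (b-a)), (Rabs_right (d-c)) in Hsmall by lra.
      replace ((INR n + 1) / INR N) with (INR n / INR N + / INR N) in * by (field; lra).
      set (s := INR n / INR N) in *. set (e := / INR N) in *.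
      assert (Hstep : Rabs (f (a + (s + e) * (x - a)) (c + (s + e) * (y - c))
                            - f (a + s * (x - a)) (c + s * (y - c))) < 1).
      { apply Hunif; try (split; nra); apply Rabs_def1; nra. }
      apply Rabs_def2 in Hstep. revert IH.
      unfold Rabs; repeat destruct Rcase_abs; lra. }
  specialize (Hchain N (le_n N)).
  replace (INR N / INR N) with 1 in Hchain by (field; lra).
  now replace (a + 1 * (x - a)) with x in Hchain by ring;
    replace (c + 1 * (y - c)) with y in Hchain by ring.
Qed.

(** Serves to bound all members [G m n] of a finite family at once. *)
Lemma uniform_bound (P : nat -> R -> Prop) :
  (forall n B B', B <= B' -> P n B -> P n B') -> (forall n, exists B, P n B) ->
  forall N : nat, exists B, 0 <= B /\ forall n, (n <= N)%nat -> P n B.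
Proof.
  intros Hmono HP N. induction N as [|N [B [HB0 HB]]].
  - destruct (HP O) as [B HB]. exists (Rmax 0 B). split; [apply Rmax_l|].
    intros n Hn. replace n with O by lia. apply Hmono with B; [apply Rmax_r|exact HB].
  - destruct (HP (S N)) as [B' HB']. exists (Rmax B B').
    split; [apply Rle_trans with B; [exact HB0|apply Rmax_l]|].
    intros n Hn. destruct (Nat.eq_dec n (S N)) as [->|Hne].
    + apply Hmono with B'; [apply Rmax_r|exact HB'].
    + apply Hmono with B; [apply Rmax_l|apply HB; lia].
Qed.

(** * Taylor expansion of jets *)

(** [G m n] stands for the derivative [d^m/dx^m d^n/dy^n] of [G 0 0] on the
    rectangle. Continuity is asked at every point of the plane: the boundary of
    the rectangle then needs no one-sided notion of continuity. *)
Record jet (k : nat) (a b c d : R) (G : nat -> nat -> R -> R -> R) : Prop := {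
  jet_continuous : forall m n x y, (m + n <= k)%nat -> continuity_2d_pt (G m n) x y;
  jet_dx : forall m n x y, (m + n < k)%nat -> a < x < b -> c < y < d ->
    is_derive (fun s : R => G m n s y) x (G (S m) n x y);
  jet_dy : forall m n x y, (m + n < k)%nat -> a < x < b -> c < y < d ->
    is_derive (fun t : R => G m n x t) y (G m (S n) x y) }.

(** The [l]-fold derivative of [G m n] in the direction [(dx, dy)]. Iterating
    [dx d/dx + dy d/dy] keeps binomial coefficients out of the proofs; they
    reappear by computation for concrete [l]. *)
Fixpoint dir_deriv (dx dy : R) (l : nat) (G : nat -> nat -> R -> R -> R)
  (m n : nat) (x y : R) : R :=
  match l with
  | O => G m n x y
  | S l' => dx * dir_deriv dx dy l' G (S m) n x y + dy * dir_deriv dx dy l' G m (S n) x y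
  end.

Definition taylor (dx dy : R) (l : nat) (G : nat -> nat -> R -> R -> R)
  (m n : nat) (x y : R) : R :=
  sum_f_R0 (fun i => dir_deriv dx dy i G m n x y / INR (fact i)) l.

Lemma locally_between (a b x : R) : a < x < b -> locally x (fun s => a < s < b).
Proof.
  intros [Ha Hb].
  exact (locally_interval (fun s => a < s < b) x a b Ha Hb (fun s H1 H2 => conj H1 H2)).
Qed.

Lemma locally_2d_between (a b c d x y : R) : a < x < b -> c < y < d ->
  locally_2d (fun u v => a < u < b /\ c < v < d) x y.
Proof.
  intros Hx Hy. apply locally_2d_locally.
  destruct (locally_between _ _ _ Hx) as [e1 He1], (locally_between _ _ _ Hy) as [e2 He2].
  exists (mkposreal _ (Rmin_pos _ _ (cond_pos e1) (cond_pos e2))).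
  intros [u v] [Hu Hv]; simpl in *.
  split; [apply He1|apply He2]; eapply ball_le; try eassumption;
    simpl; [apply Rmin_l|apply Rmin_r].
Qed.

(** By the chain rule, which applies because the partial derivatives of a jet
    are continuous. *)
Lemma is_derive_dir_deriv k a b c d G dx dy : jet k a b c d G ->
  forall l m n x y t, (m + n + l < k)%nat ->
  a < x + t * dx < b -> c < y + t * dy < d ->
  is_derive (fun s : R => dir_deriv dx dy l G m n (x + s * dx) (y + s * dy)) t
    (dir_deriv dx dy (S l) G m n (x + t * dx) (y + t * dy)).
Proof.
  intros [Hc Hdx Hdy]. induction l as [|l IH]; intros m n x y t Hl Hx Hy.
  - simpl.
    assert (Hlx : locally_2d (fun u v => a < u < b /\ c < v < d) (x + t * dx) (y + t * dy))
      by now apply locally_2d_between.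
    assert (Hdiff : differentiable_pt_lim (G m n) (x + t * dx) (y + t * dy)
       (G (S m) n (x + t * dx) (y + t * dy)) (G m (S n) (x + t * dx) (y + t * dy))).
    { apply filterdiff_differentiable_pt_lim.
      apply (is_derive_filterdiff (G m n) _ _ (G (S m) n)).
      - apply locally_2d_locally in Hlx. revert Hlx. apply filter_imp.
        intros u [Hu Hv]. apply Hdx; [lia|assumption..].
      - apply Hdy; [lia|assumption..].
      - apply (continuity_2d_pt_filterlim (G (S m) n)), Hc; lia. }
    apply is_derive_Reals.
    replace (dx * _ + dy * _) with
      (G (S m) n (x + t * dx) (y + t * dy) * dx + G m (S n) (x + t * dx) (y + t * dy) * dy) by ring.
    apply (derivable_pt_lim_comp_2d (G m n) (fun s => x + s * dx) (fun s => y + s * dy)); [exact Hdiff|..];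
      apply is_derive_Reals; auto_derive; trivial; ring.
  - apply (is_derive_plus (V := R_NormedModule)); apply is_derive_scal;
      apply IH; (lia || assumption).
Qed.

Lemma Derive_n_dir_deriv k a b c d G dx dy m n x y : jet k a b c d G ->
  forall l t, (m + n + l <= k)%nat ->
  a < x + t * dx < b -> c < y + t * dy < d ->
  ex_derive_n (fun s : R => G m n (x + s * dx) (y + s * dy)) l t /\
  Derive_n (fun s : R => G m n (x + s * dx) (y + s * dy)) l t
  = dir_deriv dx dy l G m n (x + t * dx) (y + t * dy).
Proof.
  intros HG. induction l as [|l IH]; intros t Hl Hx Hy; [now simpl|].
  assert (Hcont : forall z dz : R, continuous (fun s : R => z + s * dz) t).
  { intros z dz. apply (ex_derive_continuous (fun s : R => z + s * dz)). now auto_derive. }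
  assert (Hloc : locally t (fun s =>
    dir_deriv dx dy l G m n (x + s * dx) (y + s * dy)
    = Derive_n (fun s : R => G m n (x + s * dx) (y + s * dy)) l s)).
  { assert (Hlx := Hcont x dx _ (locally_between _ _ _ Hx)).
    assert (Hly := Hcont y dy _ (locally_between _ _ _ Hy)).
    unfold filtermap in Hlx, Hly.
    generalize (filter_and _ _ Hlx Hly).
    apply filter_imp. intros s [Hxs Hys]. symmetry. apply IH; [lia|assumption..]. }
  pose proof (is_derive_ext_loc _ _ _ _ Hloc
    (is_derive_dir_deriv k a b c d G dx dy HG l m n x y t ltac:(lia) Hx Hy)) as Hder.
  split; [exact (ex_intro _ _ Hder)|]. simpl Derive_n. now apply is_derive_unique.
Qed.

Lemma dir_deriv_bound (dx dy r B x y : R) (G : nat -> nat -> R -> R -> R) (k : nat) :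
  Rabs dx <= r -> Rabs dy <= r ->
  (forall m n : nat, (m + n <= k)%nat -> Rabs (G m n x y) <= B) ->
  forall l m n : nat, (m + n + l <= k)%nat ->
  Rabs (dir_deriv dx dy l G m n x y) <= (2 * r) ^ l * B.
Proof.
  intros Hdx Hdy HB. induction l as [|l IH]; intros m n Hl; simpl.
  - rewrite Rmult_1_l. apply HB; lia.
  - eapply Rle_trans; [apply Rabs_triang|]. rewrite !Rabs_mult.
    assert (H1 := IH (S m) n ltac:(lia)). assert (H2 := IH m (S n) ltac:(lia)).
    set (C := (2 * r) ^ l * B) in *.
    replace (2 * r * (2 * r) ^ l * B) with (r * C + r * C) by (unfold C; ring).
    apply Rplus_le_compat; apply Rmult_le_compat; trivial; apply Rabs_pos.
Qed.

Lemma segment_between (a b x dx t : R) :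
  a < x < b -> a < x + dx < b -> 0 <= t <= 1 -> a < x + t * dx < b.
Proof. intros Hx Hx' Ht. destruct (Rle_dec 0 dx); split; nra. Qed.

(** Lagrange's form of the remainder for the restriction of [G m n] to the
    segment, which stays inside by convexity. *)
Lemma taylor_interior k a b c d G B dx dy r x y m n l : jet k a b c d G ->
  (forall m n x y, (m + n <= k)%nat -> a <= x <= b -> c <= y <= d ->
     Rabs (G m n x y) <= B) ->
  (m + n + l < k)%nat ->
  a < x < b -> c < y < d -> a < x + dx < b -> c < y + dy < d ->
  Rabs dx <= r -> Rabs dy <= r ->
  Rabs (G m n (x + dx) (y + dy) - taylor dx dy l G m n x y) <= B * (2 * r) ^ S l.
Proof.
  intros HG HB Hl Hx Hy Hx' Hy' Hdx Hdy.
  assert (Hseg : forall t, 0 <= t <= 1 -> a < x + t * dx < b /\ c < y + t * dy < d).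
  { intros t Ht. split; apply segment_between; assumption. }
  destruct (Taylor_Lagrange (fun s => G m n (x + s * dx) (y + s * dy)) l 0 1 Rlt_0_1)
    as [z [Hz Heq]].
  { intros t Ht i Hi. destruct (Hseg t Ht). eapply Derive_n_dir_deriv; try eassumption. lia. }
  rewrite !Rmult_1_l in Heq. rewrite Heq. clear Heq.
  replace (sum_f_R0 _ l) with (taylor dx dy l G m n x y).
  2: { unfold taylor. apply sum_eq. intros i Hi.
       destruct (Hseg 0 ltac:(lra)).
       rewrite (proj2 (Derive_n_dir_deriv k a b c d G dx dy m n x y HG i 0 ltac:(lia) H H0)).
       rewrite Rminus_0_r, pow1, !Rmult_0_l, !Rplus_0_r. unfold Rdiv. ring. }
  destruct (Hseg z ltac:(lra)) as [Hzx Hzy].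
  rewrite (proj2 (Derive_n_dir_deriv k a b c d G dx dy m n x y HG (S l) z ltac:(lia) Hzx Hzy)).
  match goal with |- Rabs (_ + ?e - _) <= _ => replace (_ + e - _) with e by ring end.
  rewrite Rminus_0_r, pow1, Rabs_mult.
  assert (Hfact : 1 <= INR (fact (S l))).
  { apply (le_INR 1). apply lt_O_fact. }
  assert (Hd : Rabs (dir_deriv dx dy (S l) G m n (x + z * dx) (y + z * dy)) <= (2 * r) ^ S l * B).
  { apply (dir_deriv_bound dx dy r B _ _ G k Hdx Hdy); [|lia].
    intros m' n' Hmn. apply HB; [exact Hmn|lra..]. }
  rewrite (Rmult_comm B). eapply Rle_trans; [|exact Hd].
  rewrite <- (Rmult_1_l (Rabs (dir_deriv _ _ _ _ _ _ _ _))) at 2.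
  apply Rmult_le_compat_r; [apply Rabs_pos|].
  unfold Rdiv; rewrite Rmult_1_l, Rabs_inv, Rabs_right by lra.
  rewrite <- Rinv_1. apply Rinv_le_contravar; lra.
Qed.

Lemma continuous_le_right_limit (phi : R -> R) (C : R) :
  continuous phi 0 -> (forall e, 0 < e <= 1 -> phi e <= C) -> phi 0 <= C.
Proof.
  intros Hphi HC. apply Rnot_lt_le. intros Hlt.
  destruct (Hphi _ (open_gt C _ Hlt)) as [d Hd].
  assert (Hd' := cond_pos d).
  set (e := Rmin (d / 2) 1).
  assert (He : 0 < e <= 1 /\ e < d).
  { unfold e, Rmin. destruct Rle_dec; lra. }
  apply (Rlt_irrefl C). apply Rlt_le_trans with (phi e); [|now apply HC].
  apply Hd. unfold ball; simpl. unfold AbsRing_ball, minus, plus, opp, abs; simpl.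
  rewrite Rabs_right; lra.
Qed.

Lemma continuous_2d_comp (g : R -> R -> R) (p q : R -> R) (t : R) :
  continuity_2d_pt g (p t) (q t) -> continuous p t -> continuous q t ->
  continuous (fun s => g (p s) (q s)) t.
Proof.
  intros Hg Hp Hq.
  apply (continuous_comp_2 p q g); [assumption..|].
  now apply continuity_2d_pt_filterlim in Hg.
Qed.

Lemma continuous_dir_deriv k a b c d G (dx dy p q : R -> R) t : jet k a b c d G ->
  continuous dx t -> continuous dy t -> continuous p t -> continuous q t ->
  forall l m n, (m + n + l <= k)%nat ->
  continuous (fun s => dir_deriv (dx s) (dy s) l G m n (p s) (q s)) t.
Proof.
  intros HG Hdx Hdy Hp Hq. induction l as [|l IH]; intros m n Hl; simpl.
  - apply continuous_2d_comp; trivial. apply (jet_continuous _ _ _ _ _ _ HG). lia.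
  - apply (continuous_plus (V := R_NormedModule));
      apply (continuous_mult (K := R_AbsRing)); trivial; apply IH; lia.
Qed.

Lemma continuous_taylor k a b c d G (dx dy p q : R -> R) t : jet k a b c d G ->
  continuous dx t -> continuous dy t -> continuous p t -> continuous q t ->
  forall l m n, (m + n + l <= k)%nat ->
  continuous (fun s => taylor (dx s) (dy s) l G m n (p s) (q s)) t.
Proof.
  intros HG Hdx Hdy Hp Hq. unfold taylor. induction l as [|l IH]; intros m n Hl; cbn [sum_f_R0];
    unfold Rdiv.
  - apply (continuous_mult (K := R_AbsRing)); [|apply continuous_const].
    apply (continuous_dir_deriv k a b c d); trivial.
  - apply (continuous_plus (V := R_NormedModule)); [apply IH; lia|].
    apply (continuous_mult (K := R_AbsRing)); [|apply continuous_const].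
    apply (continuous_dir_deriv k a b c d); trivial.
Qed.

Lemma shrink_between (a b z e : R) : a < b -> a <= z <= b -> 0 < e <= 1 ->
  a < z + e * ((a + b) / 2 - z) < b.
Proof. intros Hab Hz He. split; nra. Qed.

(** Both ends of the segment may lie on the boundary, and even the whole
    segment. The homothety of ratio [1 - e] towards the centre of the rectangle
    moves it inside and shortens it, so that [taylor_interior] holds with a
    bound independent of [e]; both sides are continuous in [e], and [e -> 0]. *)
Lemma taylor_jet k a b c d G : a < b -> c < d -> jet k a b c d G ->
  exists K : R, 0 <= K /\
  forall m n l x y dx dy r, (m + n + l < k)%nat ->
  a <= x <= b -> c <= y <= d -> a <= x + dx <= b -> c <= y + dy <= d ->
  Rabs dx <= r -> Rabs dy <= r ->
  Rabs (G m n (x + dx) (y + dy) - taylor dx dy l G m n x y) <= K * (2 * r) ^ S l.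
Proof.
  intros Hab Hcd HG.
  assert (HB : exists B, 0 <= B /\ forall m n x y, (m + n <= k)%nat ->
    a <= x <= b -> c <= y <= d -> Rabs (G m n x y) <= B).
  { destruct (uniform_bound (fun m B => forall n x y, (m + n <= k)%nat ->
      a <= x <= b -> c <= y <= d -> Rabs (G m n x y) <= B)) with (N := k) as [B [HB0 HB]].
    - intros m B B' HBB HB n x y Hmn Hx Hy. specialize (HB n x y Hmn Hx Hy). lra.
    - intros m.
      destruct (uniform_bound (fun n B => forall x y, (m + n <= k)%nat ->
        a <= x <= b -> c <= y <= d -> Rabs (G m n x y) <= B)) with (N := k) as [B [HB0 HB]].
      + intros n B B' HBB HB x y Hmn Hx Hy. specialize (HB x y Hmn Hx Hy). lra.
      + intros n. destruct (le_dec (m + n) k) as [Hle|Hnle].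
        * destruct (continuity_2d_bounded (G m n) a b c d) as [B [HB0 HB]].
          { intros. now apply (jet_continuous _ _ _ _ _ _ HG). }
          exists B. auto.
        * exists 0. intros; lia.
      + exists B. intros n x y Hmn. apply HB; lia.
    - exists B. split; [exact HB0|]. intros m n x y Hmn. apply HB; lia. }
  destruct HB as [B [HB0 HB]]. exists B. split; [exact HB0|].
  intros m n l x y dx dy r Hl Hx Hy Hx' Hy' Hdx Hdy.
  set (px := fun e : R => x + e * ((a + b) / 2 - x)).
  set (py := fun e : R => y + e * ((c + d) / 2 - y)).
  set (sx := fun e : R => dx - e * dx). set (sy := fun e : R => dy - e * dy).
  set (phi := fun e : R => Rabs (G m n (px e + sx e) (py e + sy e)
                 - taylor (sx e) (sy e) l G m n (px e) (py e))).
  replace (Rabs _) with (phi 0).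
  2: { unfold phi, px, py, sx, sy. now rewrite !Rmult_0_l, !Rplus_0_r, !Rminus_0_r. }
  assert (Haff : forall u v, continuous (fun e : R => u + e * v) 0 /\
    continuous (fun e : R => u - e * v) 0).
  { intros u v. split; apply (ex_derive_continuous (V := R_NormedModule)); now auto_derive. }
  apply continuous_le_right_limit.
  - apply (continuous_comp _ Rabs); [|apply continuous_Rabs].
    apply (continuous_minus (V := R_NormedModule)).
    + apply continuous_2d_comp.
      * apply (jet_continuous _ _ _ _ _ _ HG). lia.
      * apply (continuous_plus (V := R_NormedModule)); apply Haff.
      * apply (continuous_plus (V := R_NormedModule)); apply Haff.
    + apply (continuous_taylor k a b c d); trivial; try apply Haff. lia.
  - intros e He.
    assert (Hr : 0 <= r) by (pose proof (Rabs_pos dx); lra).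
    assert (Hs : forall z, Rabs z <= r -> Rabs (z - e * z) <= r).
    { intros z Hz. replace (z - e * z) with ((1 - e) * z) by ring.
      rewrite Rabs_mult, Rabs_right by lra. pose proof (Rabs_pos z). nra. }
    apply taylor_interior with k a b c d; trivial.
    + now apply shrink_between.
    + now apply shrink_between.
    + unfold px, sx. replace (_ + _) with (x + dx + e * ((a + b) / 2 - (x + dx))) by ring.
      now apply shrink_between.
    + unfold py, sy. replace (_ + _) with (y + dy + e * ((c + d) / 2 - (y + dy))) by ring.
      now apply shrink_between.
    + now apply Hs.
    + now apply Hs.
Qed.

(** * Jets of functions smooth up to the boundary *)
Definition clamp (a b x : R) : R := Rmax a (Rmin b x).

Lemma clamp_between (a b x : R) : a <= b -> a <= clamp a b x <= b.
Proof. intros H. unfold clamp, Rmax, Rmin. repeat destruct Rle_dec; lra. Qed.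

Lemma clamp_id (a b x : R) : a <= x <= b -> clamp a b x = x.
Proof. intros H. unfold clamp, Rmax, Rmin. repeat destruct Rle_dec; lra. Qed.

Lemma clamp_contracts (a b x y : R) : Rabs (clamp a b x - clamp a b y) <= Rabs (x - y).
Proof.
  unfold clamp, Rmax, Rmin, Rabs.
  repeat destruct Rle_dec; repeat destruct Rcase_abs; lra.
Qed.

Lemma continuity_2d_clamp (g : R * R -> R) (a b c d x y : R) :
  a <= b -> c <= d -> continuous_on (closed_rect a b c d) g ->
  continuity_2d_pt (fun u v => g (clamp a b u, clamp c d v)) x y.
Proof.
  intros Hab Hcd Hg eps.
  assert (Hin : closed_rect a b c d (clamp a b x, clamp c d y))
    by (split; now apply clamp_between).
  destruct (Hg _ Hin (ball (g (clamp a b x, clamp c d y)) eps) (locally_ball _ _)) as [delta Hdelta].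
  exists delta. intros u v Hu Hv. apply (Hdelta (clamp a b u, clamp c d v)).
  - split; (eapply Rle_lt_trans; [apply clamp_contracts|assumption]).
  - split; now apply clamp_between.
Qed.

(** The extensions of the derivatives to the closed rectangle, composed with
    the retraction of the plane onto it, are continuous everywhere. That they
    differentiate into one another in [y] as well as in [x] is the symmetry of
    mixed derivatives. *)
Lemma Ck_closure_jet (k : nat) (a b c d : R) (w : R -> R -> R) :
  a < b -> c < d -> Ck_closure k (open_rect a b c d) (closed_rect a b c d) w ->
  exists G, jet k a b c d G /\
    (forall x y, a <= x <= b -> c <= y <= d -> G O O x y = w x y) /\
    (forall m n x y, (m + n <= k)%nat -> a < x < b -> c < y < d ->
       G m n x y = partial_derive m n w x y).
Proof.
  intros Hab Hcd [Hdiff [Hw Hext]].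
  assert (Hg : forall m n, exists g : R * R -> R, (m + n <= k)%nat ->
    continuous_on (closed_rect a b c d) g /\
    (forall x y, a < x < b -> c < y < d -> g (x, y) = partial_derive m n w x y) /\
    ((m + n = 0)%nat -> forall p, g p = w (fst p) (snd p))).
  { intros m n. destruct (Nat.eq_dec (m + n) 0) as [H0|H0].
    (* At order zero the extension is [w], which makes [G 0 0] equal to [w] on
       the boundary as well. *)
    - exists (fun p => w (fst p) (snd p)). intros _. repeat split; trivial.
      intros x y _ _. now replace m with O by lia; replace n with O by lia.
    - destruct (le_dec (m + n) k) as [Hle|Hnle]; [|exists (fun _ => 0); lia].
      destruct (Hext m n Hle) as [g [Hgc Hgd]]. exists g. intros _.
      repeat split; trivial; [|lia]. intros x y Hx Hy. apply Hgd. now split. }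
  set (g := fun m n => proj1_sig (constructive_indefinite_description _ (Hg m n))).
  assert (Hgs : forall m n, (m + n <= k)%nat ->
    continuous_on (closed_rect a b c d) (g m n) /\
    (forall x y, a < x < b -> c < y < d -> g m n (x, y) = partial_derive m n w x y) /\
    ((m + n = 0)%nat -> forall p, g m n p = w (fst p) (snd p))).
  { intros m n. unfold g. now destruct constructive_indefinite_description. }
  set (G := fun m n x y => g m n (clamp a b x, clamp c d y)).
  assert (HG : forall m n x y, (m + n <= k)%nat -> a < x < b -> c < y < d ->
     G m n x y = partial_derive m n w x y).
  { intros m n x y Hmn Hx Hy. unfold G. rewrite !clamp_id by lra. now apply Hgs. }
  exists G. split; [split|split]; [..|exact HG].
  - intros m n x y Hmn. apply continuity_2d_clamp; [lra..|]. now apply Hgs.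
  - intros m n x y Hmn Hx Hy. rewrite HG by (trivial; lia).
    apply is_derive_ext_loc with (fun s => partial_derive m n w s y).
    + generalize (locally_between _ _ _ Hx). apply filter_imp.
      intros s Hs. symmetry. apply HG; trivial; lia.
    + apply Derive_correct, (ex_diff_n_ex_deriv_inf_1 k); [lia|]. apply Hdiff. now split.
  - intros m n x y Hmn Hx Hy. rewrite HG by (trivial; lia).
    apply is_derive_ext_loc with (fun t => partial_derive m n w x t).
    + generalize (locally_between _ _ _ Hy). apply filter_imp.
      intros s Hs. symmetry. apply HG; trivial; lia.
    + rewrite <- Derive_partial_derive.
      * apply Derive_correct, (ex_diff_n_ex_deriv_inf_2 k); [lia|]. apply Hdiff. now split.
      * apply locally_2d_locally.
        generalize (locally_2d_between _ _ _ _ _ _ Hx Hy). intros Hloc.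
        apply locally_2d_locally in Hloc. revert Hloc. apply filter_imp.
        intros [s t] Hst. apply ex_diff_n_m with k; [lia|]. apply Hdiff, Hst.
  - intros x y Hx Hy. unfold G. rewrite !clamp_id by assumption.
    now rewrite (proj2 (proj2 (Hgs O O ltac:(lia)))) by lia.
Qed.

(** Partial derivatives inside the rectangle only see the restriction of [u]
    to it, so they are those of the smooth function with which [u] agrees. *)
Lemma jet_of_piece (k : nat) (a b c d : R) (u w : R -> R -> R) :
  a < b -> c < d -> Ck_closure k (open_rect a b c d) (closed_rect a b c d) w ->
  (forall x y, closed_rect a b c d (x, y) -> x <> 1 / 2 -> u x y = w x y) ->
  (forall x, a < x < b -> x <> 1 / 2) ->
  exists G, jet k a b c d G /\
    (forall x y, a <= x <= b -> c <= y <= d -> x <> 1 / 2 -> G O O x y = u x y) /\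
    (forall m n x y, (m + n <= k)%nat -> a < x < b -> c < y < d ->
       G m n x y = partial_derive m n u x y).
Proof.
  intros Hab Hcd Hw Huw Hside.
  destruct (Ck_closure_jet k a b c d w Hab Hcd Hw) as [G [HG [HG0 HGd]]].
  exists G. split; [exact HG|split].
  - intros x y Hx Hy Hne. rewrite HG0 by assumption. symmetry. apply Huw; trivial. now split.
  - intros m n x y Hmn Hx Hy. rewrite HGd by assumption. apply partial_derive_ext_loc.
    apply locally_2d_locally.
    generalize (locally_2d_between _ _ _ _ _ _ Hx Hy). intros Hloc.
    apply locally_2d_locally in Hloc. revert Hloc. apply filter_imp.
    intros [s t] [Hs Ht]; simpl in *. symmetry. apply Huw; [split; simpl; lra|now apply Hside].
Qed.

(** * Traces on the interface and the differential operator *)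
Lemma continuous_section (g : R -> R -> R) (x y : R) :
  continuity_2d_pt g x y -> filterlim (fun s => g s y) (locally x) (locally (g x y)).
Proof.
  intros Hg. apply (continuous_2d_comp g (fun s => s) (fun _ => y) x Hg).
  - apply continuous_id.
  - apply continuous_const.
Qed.

Lemma tr_minus_ext (a : R) (z g : R -> R -> R) (y : R) :
  a < 1 / 2 -> (forall x, a < x < 1 / 2 -> z x y = g x y) ->
  continuity_2d_pt g (1 / 2) y -> tr_minus z y = g (1 / 2) y.
Proof.
  intros Ha Hz Hg. apply tr_minus_eq. apply filterlim_ext_loc with (fun x => g x y).
  - assert (Hd : 0 < 1 / 2 - a) by lra. exists (mkposreal _ Hd).
    intros x Hx Hlt. symmetry. apply Hz. apply Rabs_def2 in Hx; simpl in Hx.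
    unfold minus, plus, opp in Hx; simpl in Hx. lra.
  - eapply filterlim_filter_le_1; [apply filter_le_within|]. now apply continuous_section.
Qed.

Lemma tr_plus_ext (b : R) (z g : R -> R -> R) (y : R) :
  1 / 2 < b -> (forall x, 1 / 2 < x < b -> z x y = g x y) ->
  continuity_2d_pt g (1 / 2) y -> tr_plus z y = g (1 / 2) y.
Proof.
  intros Hb Hz Hg. apply tr_plus_eq. apply filterlim_ext_loc with (fun x => g x y).
  - assert (Hd : 0 < b - 1 / 2) by lra. exists (mkposreal _ Hd).
    intros x Hx Hlt. symmetry. apply Hz. apply Rabs_def2 in Hx; simpl in Hx.
    unfold minus, plus, opp in Hx; simpl in Hx. lra.
  - eapply filterlim_filter_le_1; [apply filter_le_within|]. now apply continuous_section.
Qed.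

Lemma div_kappa_grad_const (km k0 a b : R) (u : R -> R -> R) (x y : R) :
  a < x < b -> (forall s t, a < s < b -> kappa km s t = k0) ->
  div_kappa_grad km u x y = k0 * (partial_derive 2 0 u x y + partial_derive 0 2 u x y).
Proof.
  intros Hx Hk. unfold div_kappa_grad.
  rewrite (Derive_ext_loc (fun s => kappa km s y * partial_derive 1 0 u s y) (fun s => k0 * partial_derive 1 0 u s y)).
  2: { generalize (locally_between _ _ _ Hx). apply filter_imp.
       intros s Hs. now rewrite (Hk s y Hs). }
  rewrite (Derive_ext (fun t => kappa km x t * partial_derive 0 1 u x t) (fun t => k0 * partial_derive 0 1 u x t))
    by (intros t; now rewrite (Hk x t Hx)).
  rewrite !Derive_scal.
  change (Derive (fun s => partial_derive 1 0 u s y) x) with (partial_derive 2 0 u x y).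
  change (Derive (partial_derive 0 1 u x) y) with (partial_derive 0 2 u x y).
  ring.
Qed.

(** * The two stencil expansions *)

(** Reflections in [x] and in [y] permute the four corners, so only even powers
    of both increments survive in the sum of the expansions; the fifth order is
    therefore absent and the first neglected terms have order six. *)
Lemma five_point_interior (a b c d : R) G : a < b -> c < d -> jet 6 a b c d G ->
  exists K : R, 0 <= K /\ forall x y h : R, 0 <= h ->
    a <= x - h -> x + h <= b -> c <= y - h -> y + h <= d ->
    Rabs (G 0%nat 0%nat (x - h) (y - h) + G 0%nat 0%nat (x + h) (y - h)
          + G 0%nat 0%nat (x - h) (y + h) + G 0%nat 0%nat (x + h) (y + h)
          - (4 * G 0%nat 0%nat x y
             + 2 * h ^ 2 * (G 2%nat 0%nat x y + G 0%nat 2%nat x y)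
             + h ^ 4 / 6 * (G 0%nat 4%nat x y + G 4%nat 0%nat x y
                            + 6 * G 2%nat 2%nat x y)))
    <= K * h ^ 6.
Proof.
  intros Hab Hcd HG. destruct (taylor_jet 6 a b c d G Hab Hcd HG) as [K [HK0 HK]].
  exists (256 * K). split; [lra|]. intros x y h Hh Hxl Hxr Hyl Hyr.
  assert (Habs : Rabs h <= h) by (rewrite Rabs_right; lra).
  assert (Habs' : Rabs (- h) <= h) by now rewrite Rabs_Ropp.
  assert (HT : forall dx dy, (dx = h \/ dx = - h) -> (dy = h \/ dy = - h) ->
    Rabs (G 0%nat 0%nat (x + dx) (y + dy) - taylor dx dy 5 G 0 0 x y) <= K * (2 * h) ^ 6).
  { intros dx dy Hdx Hdy. apply HK; [lia|lra|lra|..];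
      destruct Hdx as [->| ->], Hdy as [->| ->]; (lra || assumption). }
  assert (T1 := HT (- h) (- h) ltac:(auto) ltac:(auto)).
  assert (T2 := HT h (- h) ltac:(auto) ltac:(auto)).
  assert (T3 := HT (- h) h ltac:(auto) ltac:(auto)).
  assert (T4 := HT h h ltac:(auto) ltac:(auto)). clear HT.
  change (x + - h) with (x - h) in *. change (y + - h) with (y - h) in *.
  replace (4 * G 0%nat 0%nat x y + _ + _) with
    (taylor (- h) (- h) 5 G 0 0 x y + taylor h (- h) 5 G 0 0 x y
     + taylor (- h) h 5 G 0 0 x y + taylor h h 5 G 0 0 x y).
  2: { unfold taylor. cbn [sum_f_R0 dir_deriv]. rewrite !INR_IZR_INZ.
       cbn -[Rplus Rmult Rdiv Rinv pow]. field. }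
  replace (256 * K * h ^ 6) with (4 * (K * (2 * h) ^ 6)) by ring.
  apply Rabs_le_between in T1, T2, T3, T4. apply Rabs_le. lra.
Qed.

(** [A] is the jet on the side of the node, with coefficient [k0], and [B] the
    jet across the line [x = X]; [s] is the step pointing away from that line.
    Orders zero to three of the scheme values are kept, but only orders zero and
    one of the second derivatives, which carry a factor [h^2]. *)
Lemma five_point_interface (a b a' b' c d X k0 ks : R) A B :
  a < b -> a' < b' -> c < d -> jet 6 a b c d A -> jet 6 a' b' c d B ->
  a <= X <= b -> a' <= X <= b' -> 0 <= k0 -> 0 <= ks ->
  exists K : R, 0 <= K /\ forall y s h : R, 0 <= h -> s = h \/ s = - h ->
    a <= X + 3 * s / 2 <= b -> a <= X + s / 2 <= b -> a' <= X - s / 2 <= b' ->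
    c <= y - h -> y + h <= d -> A 0%nat 0%nat X y = B 0%nat 0%nat X y ->
    Rabs (- k0 / 2 * (A 0%nat 0%nat (X + 3 * s / 2) (y - h)
                      + A 0%nat 0%nat (X + 3 * s / 2) (y + h))
          - ks / 2 * (B 0%nat 0%nat (X - s / 2) (y - h)
                      + B 0%nat 0%nat (X - s / 2) (y + h))
          + (k0 + ks) * A 0%nat 0%nat (X + s / 2) y
          + h ^ 2 * k0 * (A 2%nat 0%nat (X + s / 2) y + A 0%nat 2%nat (X + s / 2) y)
          - (s * (- k0 * A 1%nat 0%nat X y
                  + ks / 2 * (A 1%nat 0%nat X y + B 1%nat 0%nat X y))
             + h ^ 2 * (ks / 8 * (A 2%nat 0%nat X y - B 2%nat 0%nat X y)
                        + / 2 * (k0 * A 0%nat 2%nat X y - ks * B 0%nat 2%nat X y))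
             + s * h ^ 2 * (- k0 / 24 * A 3%nat 0%nat X y
                            + ks / 48 * (A 3%nat 0%nat X y + B 3%nat 0%nat X y)
                            + / 4 * (- k0 * A 1%nat 2%nat X y
                                     + ks * B 1%nat 2%nat X y))))
    <= K * h ^ 4.
Proof.
  intros Hab Hab' Hcd HA HB HX HX' Hk0 Hks.
  destruct (taylor_jet 6 a b c d A Hab Hcd HA) as [KA [HKA0 HKA]].
  destruct (taylor_jet 6 a' b' c d B Hab' Hcd HB) as [KB [HKB0 HKB]].
  exists (256 * (k0 + (k0 + ks)) * KA + 256 * ks * KB + 32 * k0 * KA).
  split; [pose proof (Rmult_le_pos _ _ Hk0 HKA0); pose proof (Rmult_le_pos _ _ Hks HKA0);
          pose proof (Rmult_le_pos _ _ Hks HKB0); lra|].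
  intros y s h Hh Hs H3 H1 H1' Hyl Hyr Heq.
  (* All increments are at most [3h/2]; [2h] is a convenient common bound. *)
  assert (Hr : forall z, - (2 * h) <= z <= 2 * h -> Rabs z <= 2 * h)
    by (intros; now apply Rabs_le).
  assert (Hsh : - h <= s <= h) by (destruct Hs; lra).
  assert (T1 : Rabs (A 0%nat 0%nat (X + 3 * s / 2) (y + - h) - taylor (3 * s / 2) (- h) 3 A 0 0 X y)
    <= KA * (2 * (2 * h)) ^ 4) by (apply HKA; [lia| | | | |apply Hr|apply Hr]; lra).
  assert (T2 : Rabs (A 0%nat 0%nat (X + 3 * s / 2) (y + h) - taylor (3 * s / 2) h 3 A 0 0 X y)
    <= KA * (2 * (2 * h)) ^ 4) by (apply HKA; [lia| | | | |apply Hr|apply Hr]; lra).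
  assert (T3 : Rabs (B 0%nat 0%nat (X + - (s / 2)) (y + - h) - taylor (- (s / 2)) (- h) 3 B 0 0 X y)
    <= KB * (2 * (2 * h)) ^ 4) by (apply HKB; [lia| | | | |apply Hr|apply Hr]; lra).
  assert (T4 : Rabs (B 0%nat 0%nat (X + - (s / 2)) (y + h) - taylor (- (s / 2)) h 3 B 0 0 X y)
    <= KB * (2 * (2 * h)) ^ 4) by (apply HKB; [lia| | | | |apply Hr|apply Hr]; lra).
  assert (T5 : Rabs (A 0%nat 0%nat (X + s / 2) (y + 0) - taylor (s / 2) 0 3 A 0 0 X y)
    <= KA * (2 * (2 * h)) ^ 4) by (apply HKA; [lia| | | | |apply Hr|apply Hr]; lra).
  assert (T6 : Rabs (A 2%nat 0%nat (X + s / 2) (y + 0) - taylor (s / 2) 0 1 A 2 0 X y)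
    <= KA * (2 * (2 * h)) ^ 2) by (apply HKA; [lia| | | | |apply Hr|apply Hr]; lra).
  assert (T7 : Rabs (A 0%nat 2%nat (X + s / 2) (y + 0) - taylor (s / 2) 0 1 A 0 2 X y)
    <= KA * (2 * (2 * h)) ^ 2) by (apply HKA; [lia| | | | |apply Hr|apply Hr]; lra).
  clear HKA HKB Hr. rewrite !Rplus_0_r in *.
  change (y + - h) with (y - h) in *. change (X + - (s / 2)) with (X - s / 2) in *.
  assert (Hscale : forall q T C, 0 <= q -> Rabs T <= C -> - (q * C) <= q * T <= q * C).
  { intros q T C Hq HT. apply Rabs_le_between in HT. nra. }
  assert (Hh2 : 0 <= h ^ 2 * k0) by (apply Rmult_le_pos; [apply pow2_ge_0|lra]).
  apply (Hscale (k0 / 2)) in T1, T2; [|lra..].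
  apply (Hscale (ks / 2)) in T3, T4; [|lra..].
  apply (Hscale (k0 + ks)) in T5; [|lra].
  apply (Hscale (h ^ 2 * k0)) in T6, T7; [|lra..].
  clear Hscale.
  replace (s * (- k0 * A 1%nat 0%nat X y + _) + _ + _) with
    (- (k0 / 2 * (taylor (3 * s / 2) (- h) 3 A 0 0 X y + taylor (3 * s / 2) h 3 A 0 0 X y))
     - ks / 2 * (taylor (- (s / 2)) (- h) 3 B 0 0 X y + taylor (- (s / 2)) h 3 B 0 0 X y)
     + (k0 + ks) * taylor (s / 2) 0 3 A 0 0 X y
     + h ^ 2 * k0 * (taylor (s / 2) 0 1 A 2 0 X y + taylor (s / 2) 0 1 A 0 2 X y)).
  2: { clear - Hs Heq. unfold taylor. cbn [sum_f_R0 dir_deriv]. rewrite !INR_IZR_INZ.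
       cbn -[Rplus Rmult Rdiv Rinv pow]. rewrite Heq.
       destruct Hs as [-> | ->]; field. }
  apply Rabs_le. nra.
Qed.

(** * The grid *)
Lemma gridh_bounds (M : nat) : 0 < gridh M /\ INR (gridN M) * gridh M = 1.
Proof.
  unfold gridh.
  assert (0 < INR (gridN M)) by (apply lt_0_INR; unfold gridN; lia).
  split; [apply Rdiv_lt_0_compat; lra|field; lra].
Qed.

Lemma gridpt_S (M i : nat) : gridpt M (i + 1) = gridpt M i + gridh M.
Proof. unfold gridpt. rewrite plus_INR. simpl. ring. Qed.

Lemma gridpt_pred (M i : nat) : (1 <= i)%nat -> gridpt M (i - 1) = gridpt M i - gridh M.
Proof. intros Hi. unfold gridpt. rewrite minus_INR by lia. simpl. ring. Qed.

Lemma gridpt_le (M i j : nat) : (i <= j)%nat -> gridpt M i <= gridpt M j.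
Proof.
  intros Hij. unfold gridpt. apply Rmult_le_compat_r.
  - apply Rlt_le, gridh_bounds.
  - now apply le_INR.
Qed.

Lemma gridpt_0 (M : nat) : gridpt M 0 = 0.
Proof. unfold gridpt. simpl. ring. Qed.

Lemma gridpt_N (M : nat) : gridpt M (gridN M) = 1.
Proof. apply gridh_bounds. Qed.

Lemma gridpt_M (M : nat) : gridpt M M = 1 / 2 - gridh M / 2.
Proof.
  destruct (gridh_bounds M) as [_ HN]. unfold gridN in HN.
  rewrite plus_INR, mult_INR in HN. simpl in HN. unfold gridpt. lra.
Qed.

Lemma gridpt_inner (M j : nat) : (1 <= j <= gridN M - 1)%nat ->
  gridh M <= gridpt M j <= 1 - gridh M.
Proof.
  intros Hj.
  assert (H1 := gridpt_le M 1 j ltac:(lia)).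
  assert (H2 := gridpt_le M j (gridN M - 1) ltac:(lia)).
  rewrite gridpt_pred, gridpt_N in H2 by (unfold gridN; lia).
  assert (H3 := gridpt_S M 0). rewrite gridpt_0 in H3. simpl in H3. lra.
Qed.

(** * The truncation error *)

(** One statement for both subdomains: [k0] is the value of [kappa] there. The
    hypotheses on the coefficients say that the scheme is [- k0 / 2] times the
    difference of the corner values and four times the central one, plus [h^2]
    times the central value; the last part cancels against [u] in [h^2 f]. *)
Lemma trunc_err_inner (km ks k0 a b : R) (f u : R -> R -> R) G :
  0 < k0 -> a < b -> jet 6 a b 0 1 G ->
  (forall x y, a <= x <= b -> 0 <= y <= 1 -> x <> 1 / 2 -> G O O x y = u x y) ->
  (forall m n x y, (m + n <= 6)%nat -> a < x < b -> 0 < y < 1 ->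
     G m n x y = partial_derive m n u x y) ->
  (forall x y, a < x < b -> 0 < y < 1 -> f x y = u x y - k0 * (G 2%nat O x y + G O 2%nat x y)) ->
  exists K : R, 0 <= K /\ forall M i j : nat, (1 <= i)%nat -> (1 <= j <= gridN M - 1)%nat ->
    a <= gridpt M i - gridh M -> gridpt M i + gridh M <= b ->
    (gridpt M i + gridh M < 1 / 2 \/ 1 / 2 < gridpt M i - gridh M) ->
    coef1 km ks (region_of M i) = - / 2 * k0 -> coef2 km ks (region_of M i) = - / 2 * k0 ->
    coef3 km ks (gridh M) (region_of M i) = 2 * k0 + gridh M ^ 2 ->
    coef4 km ks (region_of M i) = - / 2 * k0 -> coef5 km ks (region_of M i) = - / 2 * k0 ->
    Rabs (trunc_err km ks f u M i j
          - k0 * errC4 u (gridpt M i) (gridpt M j) * gridh M ^ 4) <= K * gridh M ^ 6.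
Proof.
  intros Hk0 Hab HG HG0 HGd Hf.
  destruct (five_point_interior a b 0 1 G Hab Rlt_0_1 HG) as [K [HK0 HK]].
  exists (k0 / 2 * K). split; [apply Rmult_le_pos; lra|].
  intros M i j Hi Hj Ha Hb Hside C1 C2 C3 C4 C5.
  destruct (gridh_bounds M) as [Hh _]. assert (Hy := gridpt_inner M j Hj).
  unfold trunc_err, Lh. rewrite C1, C2, C3, C4, C5.
  rewrite !gridpt_S, !gridpt_pred by lia.
  set (x := gridpt M i) in *. set (y := gridpt M j) in *. set (h := gridh M) in *.
  specialize (HK x y h ltac:(lra) Ha Hb ltac:(lra) ltac:(lra)).
  unfold errC4. rewrite Hf by lra. rewrite <- !HGd by (lia || lra).
  rewrite <- !HG0 by lra.
  match type of HK with Rabs ?e <= _ => match goal with |- Rabs ?g <= _ =>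
    replace g with (- (k0 / 2) * e) by field end end.
  rewrite Rabs_mult, Rabs_Ropp, (Rabs_right (k0 / 2)) by lra.
  replace (k0 / 2 * K * h ^ 6) with (k0 / 2 * (K * h ^ 6)) by ring.
  apply Rmult_le_compat_l; [lra|exact HK].
Qed.

Theorem theorem3p1 (km ks : R) (f u : R -> R -> R)
    (hkm : 1 <= km) (hks : 1 <= ks <= km)
    (hu : exact_solution km f u) (hW : W u) :
  (exists K : R, forall M : nat, (1 <= M)%nat ->
     forall k i j : nat, SI M k i j ->
       Rabs (trunc_err km ks f u M i j
             - km ^ kron 1 k * errC4 u (gridpt M i) (gridpt M j) * gridh M ^ 4)
       <= K * gridh M ^ 6)
  /\
  (exists K : R, forall M : nat, (1 <= M)%nat ->
     forall i j : nat, SB M i j ->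
       Rabs (trunc_err km ks f u M i j
             - (errC1 km ks u M i (gridpt M j) * gridh M
                + errC2 km ks u M i (gridpt M j) * gridh M ^ 2
                + errC3 km ks u M i (gridpt M j) * gridh M ^ 3))
       <= K * gridh M ^ 4).
Proof.
  destruct hu as [Hpde [_ [Hju Hjk]]].
  destruct hW as [[w1 [Hw1 Hu1]] [w2 [Hw2 Hu2]]].
  destruct (jet_of_piece 6 0 (1 / 2) 0 1 u w1 ltac:(lra) ltac:(lra) Hw1 Hu1 ltac:(intros; lra))
    as [A [HA [HA0 HAd]]].
  destruct (jet_of_piece 6 (1 / 2) 1 0 1 u w2 ltac:(lra) ltac:(lra) Hw2 Hu2 ltac:(intros; lra))
    as [B [HB [HB0 HBd]]].
  assert (HfA : forall x y, 0 < x < 1 / 2 -> 0 < y < 1 ->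
    f x y = u x y - km * (A 2%nat O x y + A O 2%nat x y)).
  { intros x y Hx Hy. rewrite <- Hpde by (left; now split).
    rewrite (div_kappa_grad_const km km 0 (1 / 2)), !HAd; trivial; try lia; [ring|].
    intros s t Hs. unfold kappa. destruct Rlt_dec; lra. }
  assert (HfB : forall x y, 1 / 2 < x < 1 -> 0 < y < 1 ->
    f x y = u x y - 1 * (B 2%nat O x y + B O 2%nat x y)).
  { intros x y Hx Hy. rewrite <- Hpde by (right; now split).
    rewrite (div_kappa_grad_const km 1 (1 / 2) 1), !HBd; trivial; try lia; [ring|].
    intros s t Hs. unfold kappa. destruct Rlt_dec; lra. }
  split.
  - destruct (trunc_err_inner km ks km 0 (1 / 2) f u A ltac:(lra) ltac:(lra) HA HA0 HAd HfA)
      as [K1 [HK10 HK1]].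
    destruct (trunc_err_inner km ks 1 (1 / 2) 1 f u B ltac:(lra) ltac:(lra) HB HB0 HBd HfB)
      as [K2 [HK20 HK2]].
    exists (K1 + K2). intros M HM k i j Hij.
    destruct (gridh_bounds M) as [Hh _]. assert (HxM := gridpt_M M).
    assert (Hh6 : 0 <= gridh M ^ 6) by (apply pow_le; lra).
    destruct Hij as [[-> [Hi Hj]]|[-> [Hi Hj]]]; cbn [kron Nat.eqb pow].
    + assert (Hx := gridpt_inner M i ltac:(unfold gridN; lia)).
      assert (Hx' := gridpt_le M (i + 1) M ltac:(lia)). rewrite gridpt_S in Hx'.
      assert (Hr : region_of M i = RegI1).
      { unfold region_of. destruct (Nat.ltb_spec i M); [trivial|lia]. }
      specialize (HK1 M i j ltac:(lia) Hj ltac:(lra) ltac:(lra) ltac:(lra)).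
      rewrite Hr in HK1. specialize (HK1 eq_refl eq_refl eq_refl eq_refl eq_refl).
      rewrite Rmult_1_r. eapply Rle_trans; [exact HK1|]. nra.
    + assert (Hx := gridpt_inner M i ltac:(lia)).
      assert (Hx' := gridpt_le M (M + 1) (i - 1) ltac:(lia)).
      rewrite gridpt_S, gridpt_pred in Hx' by lia.
      assert (Hr : region_of M i = RegI2).
      { unfold region_of. destruct (Nat.ltb_spec i M); [lia|].
        destruct (Nat.eqb_spec i M); [lia|]. destruct (Nat.eqb_spec i (M + 1)); [lia|trivial]. }
      specialize (HK2 M i j ltac:(lia) Hj ltac:(lra) ltac:(lra) ltac:(lra)).
      rewrite Hr in HK2. cbn [coef1 coef2 coef3 coef4 coef5] in HK2.
      specialize (HK2 ltac:(lra) ltac:(lra) ltac:(lra) ltac:(lra) ltac:(lra)).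
      eapply Rle_trans; [exact HK2|]. nra.
  - assert (HtA : forall m n y, (m + n <= 6)%nat -> 0 < y < 1 ->
      tr_minus (partial_derive m n u) y = A m n (1 / 2) y).
    { intros m n y Hmn Hy. apply (tr_minus_ext 0); [lra|..].
      - intros x Hx. symmetry. now apply HAd.
      - now apply (jet_continuous _ _ _ _ _ _ HA). }
    assert (HtB : forall m n y, (m + n <= 6)%nat -> 0 < y < 1 ->
      tr_plus (partial_derive m n u) y = B m n (1 / 2) y).
    { intros m n y Hmn Hy. apply (tr_plus_ext 1); [lra|..].
      - intros x Hx. symmetry. now apply HBd.
      - now apply (jet_continuous _ _ _ _ _ _ HB). }
    assert (Hu0 : forall y, 0 < y < 1 -> A O O (1 / 2) y = B O O (1 / 2) y).
    { intros y Hy. specialize (Hju y Hy). unfold jump in Hju.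
      rewrite (tr_minus_ext 0 u (A O O)), (tr_plus_ext 1 u (B O O)) in Hju; try lra.
      - intros x Hx. symmetry. apply HB0; lra.
      - apply (jet_continuous _ _ _ _ _ _ HB); lia.
      - intros x Hx. symmetry. apply HA0; lra.
      - apply (jet_continuous _ _ _ _ _ _ HA); lia. }
    assert (Hflux : forall y, 0 < y < 1 -> B 1%nat O (1 / 2) y = km * A 1%nat O (1 / 2) y).
    { intros y Hy. specialize (Hjk y Hy). unfold jump in Hjk.
      rewrite (tr_minus_ext 0 _ (fun x t => km * A 1%nat O x t)), (tr_plus_ext 1 _ (B 1%nat O)) in Hjk;
        try lra.
      - intros x Hx. unfold kappa. destruct Rlt_dec; [lra|]. rewrite HBd by (lia || lra). ring.
      - apply (jet_continuous _ _ _ _ _ _ HB); lia.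
      - intros x Hx. unfold kappa. destruct Rlt_dec; [|lra]. rewrite HAd by (lia || lra). ring.
      - apply continuity_2d_pt_mult; [apply continuity_2d_pt_const|].
        apply (jet_continuous _ _ _ _ _ _ HA); lia. }
    destruct (five_point_interface 0 (1 / 2) (1 / 2) 1 0 1 (1 / 2) km ks A B)
      as [K1 [HK10 HK1]]; try lra; trivial.
    destruct (five_point_interface (1 / 2) 1 0 (1 / 2) 0 1 (1 / 2) 1 ks B A)
      as [K2 [HK20 HK2]]; try lra; trivial.
    exists (K1 + K2). intros M HM i j Hij.
    destruct (gridh_bounds M) as [Hh _]. assert (HxM := gridpt_M M).
    assert (Hh3 : 3 * gridh M <= 1).
    { assert (H0 := gridpt_le M 1 M HM). assert (H1 := gridpt_S M 0).
      rewrite gridpt_0 in H1. simpl in H1. lra. }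
    assert (Hh4 : 0 <= gridh M ^ 4) by (apply pow_le; lra).
    assert (Hy : gridh M <= gridpt M j <= 1 - gridh M)
      by (apply gridpt_inner; destruct Hij as [[_ Hj]|[_ Hj]]; exact Hj).
    unfold trunc_err, Lh, errC1, errC2, errC3, errC1_M1, errC1_M, errC2_M, errC2_M1,
      errC3_M, errC3_M1, jump, mean.
    rewrite !HtA, !HtB by (lia || lra).
    destruct Hij as [[-> Hj]|[-> Hj]].
    + assert (Hr : region_of M M = RegB1).
      { unfold region_of. now rewrite Nat.ltb_irrefl, Nat.eqb_refl. }
      rewrite Hr, Nat.eqb_refl. cbn [coef1 coef2 coef3 coef4 coef5].
      rewrite !gridpt_S, !gridpt_pred, HxM by lia.
      set (y := gridpt M j) in *. set (h := gridh M) in *.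
      (* The node lies at [1/2 - h/2], hence [s = - h]. *)
      specialize (HK1 y (- h) h ltac:(lra) ltac:(auto) ltac:(lra) ltac:(lra) ltac:(lra)
        ltac:(lra) ltac:(lra) (Hu0 y ltac:(lra))).
      replace (1 / 2 + 3 * - h / 2) with (1 / 2 - h / 2 - h) in HK1 by field.
      replace (1 / 2 + - h / 2) with (1 / 2 - h / 2) in HK1 by field.
      replace (1 / 2 - - h / 2) with (1 / 2 - h / 2 + h) in HK1 by field.
      rewrite Hflux in HK1 by lra.
      rewrite HfA by lra. rewrite !HB0, !HA0 in HK1 by lra.
      match type of HK1 with Rabs ?e <= _ => match goal with |- Rabs ?g <= _ =>
        replace g with e by field end end.
      eapply Rle_trans; [exact HK1|]. nra.
    + assert (Hr : region_of M (M + 1) = RegB2).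
      { unfold region_of. destruct (Nat.ltb_spec (M + 1) M); [lia|].
        destruct (Nat.eqb_spec (M + 1) M); [lia|]. now rewrite Nat.eqb_refl. }
      assert (Hne : (M + 1 =? M)%nat = false) by (apply Nat.eqb_neq; lia).
      rewrite Hr, Hne. cbn [coef1 coef2 coef3 coef4 coef5].
      rewrite !gridpt_S, !gridpt_pred, gridpt_S, HxM by lia.
      set (y := gridpt M j) in *. set (h := gridh M) in *.
      (* The node lies at [1/2 + h/2], hence [s = h] and the jets exchange roles. *)
      specialize (HK2 y h h ltac:(lra) ltac:(auto) ltac:(lra) ltac:(lra) ltac:(lra)
        ltac:(lra) ltac:(lra) (eq_sym (Hu0 y ltac:(lra)))).
      replace (1 / 2 - h / 2) with (1 / 2 - h / 2 + h - h) in HK2 by field.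
      replace (1 / 2 + 3 * h / 2) with (1 / 2 - h / 2 + h + h) in HK2 by field.
      replace (1 / 2 + h / 2) with (1 / 2 - h / 2 + h) in HK2 by field.
      rewrite Hflux in HK2 by lra.
      rewrite HfB by lra. rewrite !HB0, !HA0 in HK2 by lra.
      match type of HK2 with Rabs ?e <= _ => match goal with |- Rabs ?g <= _ =>
        replace g with e by field end end.
      eapply Rle_trans; [exact HK2|]. nra.
Qed.
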